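(* Let $A$ be a linear operator on a complex vector space $\mathcal V$, let $b\in\mathcal V$, and let $A = M_k - N_k$ ($k\in\mathbb N=\{0,1,2,\dots\}$) be a fully commuting operator split with every $M_k$ invertible. Fix the initial iterate $x^0\in\mathcal V$. Then, for every $k\in\mathbb N$, the value of the iterate $x^{k+1}$ obtained by executing the steps defined by $(M_0,N_0),(M_1,N_1),\dots,(M_k,N_k)$ of the nonstationary splitting method does not depend on the order in which these steps are executed. That is, for every permutation $\pi$ of $\{0,\dots,k\}$, the sequence defined by $y^0 := x^0$ and $M_{\pi(j)}\, y^{j+1} = N_{\pi(j)}\, y^{j} + b$ for $j=0,\dots,k$ satisfies $y^{k+1}=x^{k+1}$, where $M_{j}x^{j+1}=N_{j}x^{j}+b$ for $j=0,\dots,k$.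
   Context: To solve $Ax=b$, a nonstationary splitting method uses linear operators $M_k,N_k$ with $A=M_k-N_k$ for all $k\in\mathbb N$, where $M_k$ is assumed to be invertible, and iterates $M_k x^{k+1} = N_k x^k + b$. The step defined by $(M_k,N_k)$ is the map $x\mapsto M_k^{-1}(N_k x+b)$. The operator split is called fully commuting if for all $i,j\in\mathbb N$: $M_iN_j=N_jM_i$, $M_iM_j=M_jM_i$ and $N_iN_j=N_jN_i$. *)

(* Defs.v *)
From mathcomp Require Import all_boot all_order all_algebra.
From mathcomp Require Import complex reals.
Set Implicit Arguments.
Unset Strict Implicit.
Unset Printing Implicit Defensive.
Import GRing.Theory.
Local Open Scope ring_scope.

Definition operator_split (K : fieldType) (V : lmodType K)
    (A : {linear V -> V}) (M N : nat -> {linear V -> V}) : Prop :=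
  forall (k : nat) (v : V), A v = M k v - N k v.

Definition fully_commuting (K : fieldType) (V : lmodType K)
    (M N : nat -> {linear V -> V}) : Prop :=
  forall i j : nat,
    [/\ M i \o N j =1 N j \o M i,
        M i \o M j =1 M j \o M i
      & N i \o N j =1 N j \o N i].

(* z 0, ..., z n are the iterates obtained from x0 by executing, in this
   order, the n steps defined by (M (s 0), N (s 0)), ...,
   (M (s (n-1)), N (s (n-1))); the values z i with i > n are irrelevant. *)
Definition splitting_iterates (K : fieldType) (V : lmodType K)
    (M N : nat -> {linear V -> V}) (b x0 : V)
    (n : nat) (s : 'I_n -> nat) (z : nat -> V) : Prop :=
  z 0%N = x0 /\ forall j : 'I_n, M (s j) (z j.+1) = N (s j) (z j) + b.

(* The implicit steps can always be executed, and they determine the iterates. *)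
Lemma splitting_iterates_exist (K : fieldType) (V : lmodType K)
    (M N : nat -> {linear V -> V}) (b x0 : V) (n : nat) (s : 'I_n -> nat) :
  (forall k, bijective (M k)) ->
  exists z : nat -> V, splitting_iterates M N b x0 s z.
Proof.
move=> Mbij; elim: n s => [|n IHn] s; first by exists (fun=> x0); split=> // -[].
have [z [z0 zS]] := IHn (s \o widen_ord (leqnSn n)).
have [Minv _ MinvK] := Mbij (s ord_max).
exists (fun i => if (i <= n)%N then z i else Minv (N (s ord_max) (z n) + b)).
split=> // j /=; case: (ltnP j n) => [lt_jn | le_nj].
  rewrite ltnW //; have := zS (Ordinal lt_jn).
  by rewrite /= (_ : widen_ord _ _ = j) //; apply: val_inj.
have -> : j = ord_max by apply/val_inj/eqP; rewrite eqn_leq le_nj -ltnS ltn_ord.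
by rewrite /= leqnn MinvK.
Qed.

Lemma splitting_iterates_uniq (K : fieldType) (V : lmodType K)
    (M N : nat -> {linear V -> V}) (b x0 : V) (n : nat) (s : 'I_n -> nat)
    (z z' : nat -> V) :
  (forall k, bijective (M k)) ->
  splitting_iterates M N b x0 s z -> splitting_iterates M N b x0 s z' ->
  forall i : nat, (i <= n)%N -> z i = z' i.
Proof.
move=> Mbij [z0 zS] [z'0 z'S]; elim=> [|i IHi] lt_in; first by rewrite z0.
apply: (bij_inj (Mbij (s (Ordinal lt_in)))).
by rewrite (zS (Ordinal lt_in)) (z'S (Ordinal lt_in)) /= IHi // ltnW.
Qed.

(* Main.v *)
Require Import Defs.
From mathcomp Require Import all_boot all_order all_algebra all_fingroup.
From mathcomp Require Import complex reals.
Set Implicit Arguments.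
Unset Strict Implicit.
Import GRing.Theory.
Local Open Scope ring_scope.

(** The step map T_i v = M_i^-1 (N_i v + b) satisfies
    M_j M_i T_i T_j v = N_i N_j v + N_i b + M_j b
                      = N_i N_j v + N_i b + N_j b + A b,
    which is symmetric in i and j. Hence any two step maps commute, and the
    composite of finitely many of them does not depend on their order. *)

(** One update moves past a whole fold, hence two adjacent blocks of updates can be swapped. Swaps
    of two leading blocks generate all rearrangements, by [catCA_perm_ind]. *)
Lemma foldl_perm_comm (I : eqType) (T : Type) (f : T -> I -> T) (z : T)
    (s t : seq I) :
  (forall i j v, f (f v i) j = f (f v j) i) ->
  perm_eq s t -> foldl f z s = foldl f z t.
Proof.
move=> fC.
have foldl1C u v i : f (foldl f v u) i = foldl f (f v i) u.
  by elim: u v => //= j u IHu v; rewrite IHu fC.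
have foldlC u w v : foldl f (foldl f v u) w = foldl f (foldl f v w) u.
  by elim: w v => //= i w IHw v; rewrite foldl1C IHw.
move=> st.
apply: (@catCA_perm_ind _ (fun u => foldl f z s = foldl f z u) _ s t st erefl).
by move=> u1 u2 u3 ->; rewrite !foldl_cat (foldlC u1 u2).
Qed.

Lemma perm_eq_map_perm_enum (T : finType) (pi : {perm T}) :
  perm_eq (map pi (enum T)) (enum T).
Proof.
apply: uniq_perm; rewrite ?enum_uniq ?(map_inj_uniq perm_inj) ?enum_uniq //.
by move=> i; rewrite -(permKV pi i) map_f !mem_enum.
Qed.

Section SplittingStep.

Variables (K : fieldType) (V : lmodType K) (M N : nat -> {linear V -> V}).
Variable b : V.
Hypothesis Mbij : forall k, bijective (M k).

Lemma splitting_step_solvable (k : nat) (v : V) :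
  exists w, M k w == N k v + b.
Proof. by have [g _ gK] := Mbij k; exists (g (N k v + b)); rewrite gK. Qed.

(** Bijectivity is only a proposition here, so the step map is obtained by choosing a solution of
    the implicit equation; injectivity of [M k] makes it the only one. *)
Definition splitting_step (v : V) (k : nat) : V :=
  xchoose (splitting_step_solvable k v).

Lemma splitting_stepP (v : V) (k : nat) :
  M k (splitting_step v k) = N k v + b.
Proof. exact/eqP/(xchooseP (splitting_step_solvable k v)). Qed.

(** Turns the relational description into a fold, so that reordering steps becomes permuting a list.
    The induction peels off the last step, the outermost one in [foldl]. *)
Lemma splitting_iterates_foldl (x0 : V) (n : nat) (s : 'I_n -> nat)
    (z : nat -> V) :
  splitting_iterates M N b x0 s z ->
  z n = foldl splitting_step x0 (map s (enum 'I_n)).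
Proof.
elim: n s => [|n IHn] s [z0 zS]; first by rewrite enum_ord0.
rewrite enum_ordSr map_rcons foldl_rcons -map_comp -IHn; last first.
  by split=> // j; apply: (zS (widen_ord (leqnSn n) j)).
by apply: (bij_inj (Mbij (s ord_max))); rewrite splitting_stepP (zS ord_max).
Qed.

Lemma splitting_step_comm (A : {linear V -> V}) :
  operator_split A M N -> fully_commuting M N ->
  forall i j v, splitting_step (splitting_step v i) j =
                splitting_step (splitting_step v j) i.
Proof.
move=> splitA commMN i j v.
have step2E k l : M l (M k (splitting_step (splitting_step v l) k)) =
    N k (N l v) + (N k b + N l b + A b).
  have [MN _ _] := commMN l k; rewrite splitting_stepP linearD.
  rewrite [M l _](MN (splitting_step v l)) /= splitting_stepP linearD.
  (* What remains is [M l b = N l b + A b], which makes the constant term symmetric in [k] and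
     [l]. *)
  by rewrite (splitA l) -!addrA [N l b + _]addrC subrK.
have [_ MM NN] := commMN i j.
(* Compare the images under the injective [M i \o M j]; commuting the two factors on the right lets
   [step2E] apply there with [i] and [j] exchanged. *)
apply: (bij_inj (Mbij j)); apply: (bij_inj (Mbij i)).
rewrite step2E [RHS]MM /= step2E [N j b + _]addrC.
by congr (_ + _); apply: esym (NN v).
Qed.

End SplittingStep.

Theorem proposition2p4 (R : realType) (V : lmodType R[i])
    (A : {linear V -> V}) (b : V) (M N : nat -> {linear V -> V})
    (splitA : operator_split A M N)
    (commMN : fully_commuting M N)
    (Mbij : forall k : nat, bijective (M k))
    (x0 : V) (k : nat) (x : nat -> V)
    (itx : splitting_iterates M N b x0 (fun j : 'I_k.+1 => j : nat) x) :
  forall (pi : {perm 'I_k.+1}) (y : nat -> V),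
    splitting_iterates M N b x0 (fun j : 'I_k.+1 => pi j : nat) y ->
    y k.+1 = x k.+1.
Proof.
move=> pi y ity.
rewrite (splitting_iterates_foldl Mbij ity) (splitting_iterates_foldl Mbij itx).
apply: foldl_perm_comm; first exact: splitting_step_comm splitA commMN.
(* Both schedules are images under [val], of [enum] permuted by [pi] and of [enum] itself. *)
by rewrite (map_comp val pi); apply/perm_map/perm_eq_map_perm_enum.
Qed.
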